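(* Let $n\geq 4$ and let $G$ be a graph of order $n$. If $G$ contains no $C_4$, then \[ q(G)<q(F_n), \] unless $G=F_n$.
   Context: Graphs are finite, simple and undirected; the order of a graph is its number of vertices. For a graph $G$, the signless Laplacian is $Q(G)=D(G)+A(G)$, where $D(G)$ is the diagonal matrix of vertex degrees and $A(G)$ is the adjacency matrix; $q(G)$ (the $Q$-index) denotes the largest eigenvalue of $Q(G)$. $C_4$ is the cycle of length $4$; ''$G$ contains no $C_4$'' means that $G$ has no subgraph (not necessarily induced) isomorphic to $C_4$. For odd $n$, $F_n$ is the friendship graph of order $n$: the union of $\lfloor n/2\rfloor$ triangles sharing a single common vertex (and otherwise disjoint). For even $n$, $F_n$ is obtained from $F_{n-1}$ by adding one new vertex joined only to the common vertex (center) of $F_{n-1}$. Equality of graphs means isomorphism. *)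

(* Defs.v *)
From mathcomp Require Import all_boot all_order all_algebra.
From mathcomp Require Import spectral complex polyrcf.
From mathcomp Require Import boolp classical_sets reals.

Set Implicit Arguments.
Unset Strict Implicit.
Unset Printing Implicit Defensive.

Import Order.TTheory GRing.Theory Num.Theory.
Local Open Scope ring_scope.

Record sgraph := SGraph {
  vertex :> finType;
  adj : rel vertex;
  adj_sym : symmetric adj;
  adj_irr : irreflexive adj }.
Arguments adj {s}.

(* Not necessarily induced: non-edges of H may be sent to edges of G. *)
Definition has_subgraph (H G : sgraph) : Prop :=
  exists2 h : H -> G, injective h & {homo h : x y / adj x y}.

Definition isomorphic (G H : sgraph) : Prop :=
  exists2 h : G -> H, bijective h & {mono h : x y / adj x y}.

Definition C4_adj : rel 'I_4 :=
  [rel i j : 'I_4 | (j == i.+1 %[mod 4])%N || (i == j.+1 %[mod 4])%N].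

Lemma C4_adj_sym : symmetric C4_adj.
Proof. by move=> i j; rewrite /C4_adj /= orbC. Qed.

Lemma C4_adj_irr : irreflexive C4_adj.
Proof. by case=> [[|[|[|[|]]]]]. Qed.

Definition C4 : sgraph := SGraph C4_adj_sym C4_adj_irr.

(* Vertex 0 is the center; the remaining vertices form the pairs {1, 2},
   {3, 4}, ..., since 2k - 1 and 2k are the two numbers i with
   uphalf i = k.  If n is even, n - 1 is left unpaired, hence pendant. *)
Definition friendship_adj n : rel 'I_n :=
  [rel i j : 'I_n | (i != j) &&
    [|| i == 0 :> nat, j == 0 :> nat | uphalf i == uphalf j]].

Lemma friendship_adj_sym n : symmetric (@friendship_adj n).
Proof.
by move=> i j; rewrite /friendship_adj /= eq_sym orbCA [uphalf i == _]eq_sym.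
Qed.

Lemma friendship_adj_irr n : irreflexive (@friendship_adj n).
Proof. by move=> i; rewrite /friendship_adj /= eqxx. Qed.

Definition friendship n : sgraph :=
  SGraph (@friendship_adj_sym n) (@friendship_adj_irr n).

Definition degree (G : sgraph) (x : G) : nat := #|[set y | adj x y]|.

(* Rows and columns are indexed by the vertices via [enum_val]. *)
Definition adjacency_mx (R : nzRingType) (G : sgraph) : 'M[R]_#|G| :=
  \matrix_(i, j) (adj (enum_val i) (enum_val j))%:R.

Definition degree_mx (R : nzRingType) (G : sgraph) : 'M[R]_#|G| :=
  diag_mx (\row_i (degree (enum_val i))%:R).

Definition signless_laplacian (R : nzRingType) (G : sgraph) : 'M[R]_#|G| :=
  degree_mx R G + adjacency_mx R G.

(* The supremum is a maximum as soon as G has a vertex: see [Qindex_max]. *)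
Definition Qindex (R : realType) (G : sgraph) : R :=
  sup [set a : R | eigenvalue (signless_laplacian R G) a]%classic.

Lemma signless_laplacian_sym (R : nzRingType) (G : sgraph) :
  (signless_laplacian R G)^T = signless_laplacian R G.
Proof.
rewrite /signless_laplacian linearD /= tr_diag_mx; congr (_ + _).
by apply/matrixP => i j; rewrite !mxE adj_sym.
Qed.

Lemma symmetric_eigenvalue (R : realType) n (A : 'M[R]_n) :
  (0 < n)%N -> A^T = A -> exists a, eigenvalue A a.
Proof.
case: n A => // n A _ symA.
pose AC := map_mx (real_complex R) A.
have hA : AC \is hermsymmx.
  apply: realsym_hermsym.
    by apply/is_hermitianmxP; rewrite expr0 scale1r map_mx_id // map_trmx symA.
  by apply/mxOverP => i j; rewrite mxE complex_real.
have /mxOverP/(_ ord0 ord0) := hermitian_spectral_diag_real hA.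
have /orthomx_spectralP := hermitian_normalmx hA.
set P := spectralmx AC; set d := spectral_diag AC => defA.
have uP : P \in unitmx := spectral_unit AC.
have PA : P *m AC = diag_mx d *m P by rewrite {1}defA !mulmxA mulmxV // mul1mx.
move=> /complex_realP[a da]; exists a.
rewrite -(eigenvalue_map (real_complex R)) /= -/AC; apply/eigenvalueP.
exists (row ord0 P).
  by rewrite -row_mul PA row_mul row_diag_mx -scalemxAl -rowE da.
apply/negP => /eqP r0; move: uP; rewrite unitmxE.
rewrite (expand_det_row _ ord0) big1 ?unitr0 // => j _.
by move/rowP/(_ j): r0; rewrite !mxE => ->; rewrite mul0r.
Qed.

Lemma Qindex_max (R : realType) (G : sgraph) : (0 < #|G|)%N ->
  eigenvalue (signless_laplacian R G) (Qindex R G) /\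
  forall a, eigenvalue (signless_laplacian R G) a -> a <= Qindex R G.
Proof.
move=> G_gt0; rewrite /Qindex; set A := signless_laplacian R G.
have [a0 Aa0] := symmetric_eigenvalue G_gt0 (signless_laplacian_sym R G).
pose s := rootsR (char_poly A).
have sP a : eigenvalue A a = (a \in s).
  have /roots_on_rootsR/(_ a) : char_poly A != 0.
    by rewrite monic_neq0 ?char_poly_monic.
  by rewrite eigenvalue_root_char itv_boundlr.
have [m Am mP] : exists2 m, eigenvalue A m &
    forall a, eigenvalue A a -> a <= m.
  pose u := [arg max_(u > SeqSub (etrans (esym (sP a0)) Aa0)) ssval u]%O.
  exists (ssval u) => [|a]; first by rewrite sP (ssvalP u).
  rewrite sP => sa; rewrite /u; case: arg_maxP => // v _ vmax.
  exact: (vmax (SeqSub sa)).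
suff -> : sup [set a | eigenvalue A a]%classic = m by [].
apply/le_anti/andP; split; first by apply: ge_sup; [exists m | exact: mP].
by apply: ub_le_sup; [exists m; exact: mP | exact: Am].
Qed.

(* Main.v *)
Require Import Defs.
From mathcomp Require Import all_boot all_order all_algebra reals.
From mathcomp Require Import ring lra zify.

Set Implicit Arguments.
Unset Strict Implicit.
Unset Printing Implicit Defensive.
Local Open Scope ring_scope.
Import Order.TTheory GRing.Theory Num.Theory.

(** Write n for the order of G and put b = n + 1 / (n - 2).  Two regimes are
    separated by the largest degree of G.

    If no vertex has degree n - 1, then every eigenvalue of Q(G) is at most b.
    This is Merris's bound: Q(G) w <= b w holds entrywise for the vector w of
    degrees ([eigenvalue_le_supersolution]).  Absence of C4 enters through a
    double count of the walks u - v - y of length two: each y <> u closes at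
    most one of them, so the degrees of the neighbours of u add up to at most
    d(u) + n - 1 ([C4_free_sum_degree]).  It remains to bound
    d + 1 + (n - 1) / d, which is convex in d, at the ends of 2 <= d <= n - 2;
    the case d = 1 is separate ([C4_free_eigenvalue_le]).

    If some vertex c is adjacent to all the others, then absence of C4 forces
    the rest of G to be a matching together with unmatched vertices, that is, G
    is a windmill.  An eigenfunction for an eigenvalue a > 3 is determined by
    its value at c, and the equation at c says that a is a root of an explicit
    cubic, [windmill_poly n k], where k counts the matched vertices
    ([windmill_eigenvalueP]).  This cubic decreases by 2 when k increases by 1.

    The friendship graph is the windmill with at most one unmatched vertex
    ([friendship_windmill]), and it is the only one up to isomorphism
    ([windmill_isomorphic]).  Its cubic is negative at b ([windmill_poly_lt0]),
    and also at every eigenvalue a > 3 of a windmill with fewer matched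
    vertices.  By the intermediate value theorem a windmill whose cubic is
    negative at some point not below n has an eigenvalue beyond that point
    ([windmill_poly_lt0_Qindex]).  Applied to the friendship graph at b, this
    settles the first regime and all eigenvalues up to b in the second one;
    applied at an eigenvalue a > b of G, it settles the rest. *)

(** * Eigenvalues as functions on the vertices *)

(** The row of Q(G) f at x is d(x) f(x) + sum of f over the neighbours of x;
    sharing the d(x) copies of f(x) among the neighbours gives this sum. *)
Definition eigenfunction (R : nzRingType) (G : sgraph) (a : R) (f : G -> R) :=
  forall x, \sum_(y | adj x y) (f x + f y) = a * f x.

Lemma signless_eigenvalueP (R : realType) (G : sgraph) (a : R) :
  eigenvalue (signless_laplacian R G) a <->
  exists2 f : G -> R, eigenfunction a f & exists x, f x != 0.
Proof.
have actE (f : G -> R) (v : 'rV_#|G|) : (forall x, f x = v 0 (enum_rank x)) ->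
    forall x, (v *m signless_laplacian R G) 0 (enum_rank x) =
              \sum_(y | adj x y) (f x + f y).
  move=> fE x; rewrite /signless_laplacian mulmxDr mul_mx_diag !mxE enum_rankK.
  rewrite big_split sumr_const /= -fE mulr_natr /degree cardsE; congr (_ + _).
  rewrite (reindex (@enum_rank G)) /=; last exact/onW_bij/enum_rank_bij.
  rewrite [RHS]big_mkcond; apply: eq_bigr => y _.
  by rewrite !mxE !enum_rankK -fE adj_sym; case: adj; rewrite ?mulr1 ?mulr0.
split=> [/eigenvalueP[v vA v0]|[f fA [x fx]]].
  exists (fun x => v 0 (enum_rank x)) => [x|].
    by rewrite -(actE _ v) // vA mxE.
  by case/rV0Pn: v0 => i vi; exists (enum_val i); rewrite enum_valK.
pose v : 'rV_#|G| := \row_i f (enum_val i).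
have fE y : f y = v 0 (enum_rank y) by rewrite mxE enum_rankK.
apply/eigenvalueP; exists v; last first.
  by apply/rV0Pn; exists (enum_rank x); rewrite -fE.
apply/rowP => i; rewrite -[i]enum_valK (actE f) // fA [RHS]mxE -fE //.
Qed.

(** Half of the Collatz-Wielandt principle: an entrywise inequality Q w <= b w
    with w positive is compared with an eigenfunction f at the vertex where
    |f| / w is largest. *)
Lemma eigenvalue_le_supersolution (R : realType) (G : sgraph) (w : G -> R)
    (a b : R) :
  (forall x, 0 < w x) ->
  (forall x, \sum_(y | adj x y) (w x + w y) <= b * w x) ->
  eigenvalue (signless_laplacian R G) a -> a <= b.
Proof.
move=> w_gt0 wb /signless_eigenvalueP[f fa [x0 fx0]].
have [x xmax] : exists x, forall y, `|f y| / w y <= `|f x| / w x.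
  have [x _ xmax] := @arg_maxP _ _ _ x0 xpredT (fun x => `|f x| / w x) isT.
  by exists x => y; apply: xmax.
set t := `|f x| / w x in xmax.
have ft y : `|f y| <= t * w y by rewrite -ler_pdivrMr ?xmax.
have t_gt0 : 0 < t.
  by apply: lt_le_trans (xmax x0); rewrite divr_gt0 ?normr_gt0.
have fxE : `|f x| = t * w x by rewrite divfK ?gt_eqF.
rewrite -(ler_pM2r (mulr_gt0 t_gt0 (w_gt0 x))) -fxE.
apply: (@le_trans _ _ `|a * f x|); first by rewrite normrM ler_wpM2r ?ler_norm.
rewrite -fa fxE (le_trans (ler_norm_sum _ _ _)) //.
rewrite mulrCA; apply: le_trans (ler_wpM2l (ltW t_gt0) (wb x)).
rewrite mulr_sumr ler_sum // => y _; rewrite mulrDr.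
by rewrite (le_trans (ler_normD _ _)) // lerD.
Qed.

(** * Graphs without a 4-cycle and without a dominating vertex *)

Lemma C4_free_common (G : sgraph) (x y u v : G) :
  ~ has_subgraph C4 G -> x != y ->
  adj x u -> adj y u -> adj x v -> adj y v -> u = v.
Proof.
move=> C4G xy xu yu xv yv; apply/eqP/negPn/negP => uv; apply: C4G.
have neq (s t : G) : adj s t -> (s == t) = false.
  by move=> st; apply/eqP => E; rewrite E adj_irr in st.
have [ux uy vx vy] : [/\ adj u x, adj u y, adj v x & adj v y].
  by rewrite !(adj_sym _ x) !(adj_sym _ y).
exists (fun i : 'I_4 => nth x [:: x; u; y; v] i).
  have us : uniq [:: x; u; y; v].
    rewrite /= !inE !(neq _ _ xu, neq _ _ xv, neq _ _ uy, neq _ _ yv).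
    by rewrite (negPf xy) (negPf uv).
  by move=> i j /eqP; rewrite nth_uniq ?ltn_ord // => /eqP/val_inj.
by case=> [[|[|[|[|]]]]] // ? [[|[|[|[|]]]]].
Qed.

(** Exchanging the order of summation turns the sum of degrees into the sum over
    all y of the number of common neighbours of u and y: the term y = u is the
    degree of u, and every other term is at most 1. *)
Lemma C4_free_sum_degree (G : sgraph) (u : G) : ~ has_subgraph C4 G ->
  (\sum_(v | adj u v) degree v <= degree u + #|G|.-1)%N.
Proof.
move=> C4G; have -> : (\sum_(v | adj u v) degree v =
    \sum_y #|[set v | adj u v & adj y v]|)%N.
  under eq_bigr => v _ do rewrite /degree -sum1dep_card.
  rewrite (exchange_big_dep xpredT) //=; apply: eq_bigr => y _.
  by rewrite -sum1dep_card; apply: eq_bigl => v; rewrite (adj_sym y).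
rewrite (bigD1 u) //= leq_add //.
  rewrite /degree; apply: subset_leq_card; apply/subsetP => v.
  by rewrite !inE andbb.
rewrite -(cardC1 u) -sum1_card; apply: leq_sum => y yu.
apply/card_le1P => v; rewrite inE => /andP[uv yv] z; rewrite !inE.
apply/andP/eqP => [[uz yz]|-> //].
by apply: (C4_free_common C4G _ uz yz uv yv); rewrite eq_sym.
Qed.

(** The supersolution is the degree function, raised to 1 at isolated vertices
    so that it stays positive; this changes no sum, since an isolated vertex is
    nobody's neighbour. *)
Lemma C4_free_eigenvalue_le (R : realType) (G : sgraph) (a : R) :
  (4 <= #|G|)%N -> ~ has_subgraph C4 G ->
  (forall x : G, degree x <= #|G| - 2)%N ->
  eigenvalue (signless_laplacian R G) a ->
  a <= #|G|%:R + (#|G|%:R - 2)^-1.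
Proof.
set n := #|G| => n4 C4G deg.
have n4R : (4%:R : R) <= n%:R by rewrite ler_nat.
have t_gt0 : (0 : R) < n%:R - 2 by lra.
pose w (x : G) : nat := maxn 1 (degree x).
apply: (@eigenvalue_le_supersolution _ _ (fun x => (w x)%:R)) => x.
  by rewrite ltr0n leq_max.
have sumE : (\sum_(y | adj x y) (w x + w y) =
    degree x * degree x + \sum_(y | adj x y) degree y)%N.
  rewrite big_split sum_nat_const /= -/(degree x); congr (_ + _)%N.
    rewrite /w /degree cardsE.
    by case: (#|_|) => [|m] //; rewrite (maxn_idPr _).
  apply: eq_bigr => y xy; apply/maxn_idPr/card_gt0P.
  by exists x; rewrite inE adj_sym.
under eq_bigr => y _ do rewrite -natrD.
rewrite -natr_sum sumE.
have [d0|d_gt0] := posnP (degree x).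
  rewrite d0 big_pred0 => [|y].
    by rewrite mulr_ge0 // addr_ge0 // invr_ge0 ltW.
  apply/negP => xy; move/eqP: d0; rewrite /degree cards_eq0 => /eqP/setP/(_ y).
  by rewrite !inE xy.
have -> : w x = degree x by apply/maxn_idPr.
rewrite -(ler_pM2r t_gt0) [leRHS]mulrAC.
rewrite [X in _ <= X * _]mulrDl mulVf ?gt_eqF //.
(* The double count would only give n + 1 for degree 1; the only neighbour of x
   has degree at most n - 2, which gives n - 1. *)
have [d1|d2] := leqP (degree x) 1.
  have d1E : degree x = 1%N by lia.
  have /eqP/cards1P[y yE] := d1E.
  rewrite (eq_bigl (pred1 y)) => [|z]; last first.
    by have /setP/(_ z) := yE; rewrite !inE.
  rewrite big_pred1_eq d1E.
  have : ((1 * 1 + degree y)%:R : R) <= n%:R.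
    by rewrite ler_nat; have := deg y; lia.
  by nra.
have := C4_free_sum_degree x C4G; rewrite -/n.
have := deg x; move: (degree x) d2 => d d2 dn.
set s := (\sum_(y | _) _)%N => sle.
have : ((d * d + s)%:R : R) <= d%:R * d%:R + d%:R + n%:R - 1.
  have -> : (d%:R * d%:R + d%:R + n%:R - 1 : R) = (d * d + (d + n.-1))%:R.
    by rewrite !natrD natrM -subn1 natrB; [ring | lia].
  by rewrite ler_nat leq_add2l.
have d2R : (2%:R : R) <= d%:R by rewrite ler_nat.
have dnR : (d%:R : R) <= n%:R - 2%:R by rewrite -natrB ?ler_nat //; lia.
move: ((d * d + s)%:R) => S SE.
apply: le_trans (ler_wpM2r (ltW t_gt0) SE) _.
(* The difference is a concave quadratic in d, with roots n - 2 and
   (n - 1) / (n - 2) < 2. *)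
rewrite -subr_ge0.
have -> : ((n%:R * (n%:R - 2) + 1) * d%:R -
  (d%:R * d%:R + d%:R + n%:R - 1) * (n%:R - 2) : R) =
  (n%:R - 2 - d%:R) * ((n%:R - 2) * d%:R - (n%:R - 1)) by ring.
by apply: mulr_ge0; nra.
Qed.

(** * Windmills *)

(** The blades are encoded by an involution p of the vertices: p exchanges the
    two ends of a blade, and fixes the center c and the pendant vertices.  The
    number of matched vertices is then the number of points moved by p. *)
Definition windmill (G : sgraph) (c : G) (p : G -> G) :=
  [/\ involutive p, p c = c &
   forall x y : G, adj x y = (x != y) && [|| x == c, y == c | p x == y]].

Lemma windmill_exists (G : sgraph) (c : G) :
  (forall x, x != c -> adj c x) ->
  (forall x y z, x != c -> y != c -> z != c -> adj x y -> adj x z -> y = z) ->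
  exists p, windmill c p.
Proof.
move=> cA deg1.
pose m x y := [&& x != c, y != c & adj x y].
pose p x := odflt x [pick y | m x y].
have mC x y : m x y = m y x by rewrite /m adj_sym andbCA.
have pE x y : m x y -> p x = y.
  rewrite /p => xy; case: pickP => [z|/(_ y)]; last by rewrite xy.
  by case/and3P: xy => xc yc xy /and3P[_ zc xz]; apply: (deg1 x).
have pP x : p x != x -> m x (p x).
  by rewrite /p; case: pickP => //=; rewrite eqxx.
have pc : p c = c.
  by apply/eqP/negPn/negP => /pP; rewrite /m eqxx.
exists p; split=> // [x|x y].
  have [E|/pP] := eqVneq (p x) x; first by rewrite !E.
  by rewrite mC => /pE.
have [<-|xy] := eqVneq; first by rewrite adj_irr.
have [xc|xc] := eqVneq x c; first by rewrite xc cA // -xc eq_sym.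
have [yc|yc] := eqVneq y c; first by rewrite yc adj_sym cA // -yc.
rewrite /=; apply/idP/eqP => [A|E]; first by apply: pE; rewrite /m xc yc.
by have := pP x; rewrite E eq_sym xy => /(_ isT)/and3P[].
Qed.

Section Windmill.

Variables (R : realType) (G : sgraph) (c : G) (p : G -> G).
Hypothesis Gp : windmill c p.

Let k := #|[set x | p x != x]|.

(** Clearing denominators in the center equation
    a - (n - 1) = k / (a - 3) + (n - 1 - k) / (a - 1). *)
Definition windmill_poly (n k : nat) (q : R) : R :=
  (q - n%:R + 1) * (q - 3) * (q - 1) - (n%:R - 1) * (q - 3) - 2 * k%:R.

Lemma windmill_sum_center (F : G -> R) :
  \sum_(y | adj c y) F y = \sum_(y | y != c) F y.
Proof.
case: Gp => pK pc A; apply: eq_bigl => y.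
by rewrite A eqxx andbT eq_sym.
Qed.

Lemma windmill_sum_rim (F : G -> R) x : x != c ->
  \sum_(y | adj x y) F y = F c + (if p x != x then F (p x) else 0).
Proof.
case: Gp => pK pc A xc; rewrite (bigD1 c) /=; last by rewrite A xc eqxx orbT.
congr (_ + _); rewrite (eq_bigl (fun y => (p x != x) && (y == p x))) => [|y].
  by case: ifP => px; rewrite ?big_pred1_eq ?big_pred0.
rewrite A (negPf xc) /=; have [->|yc] := eqVneq y c.
  rewrite /= !andbF; apply/esym/andP => -[_ /eqP cp].
  by move/negP: xc; apply; rewrite -(pK x) -cp pc.
rewrite /= andbT; have [<-|] := eqVneq (p x) y; rewrite ?andbF ?andbT //.
by rewrite eq_sym.
Qed.

(** With the value (a - 1) (a - 3) at c, an eigenfunction takes the value a - 1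
    at a matched vertex and a - 3 at an unmatched one; this is the total over
    the vertices other than c. *)
Lemma windmill_rim_total (a : R) :
  \sum_(y : G | y != c) ((a - 3) + 2 * (p y != y)%:R) =
  (#|G|%:R - 1) * (a - 3) + 2 * k%:R.
Proof.
rewrite big_split /= sumr_const -mulr_sumr cardC1.
have G0 : (0 < #|G|)%N by apply/card_gt0P; exists c.
rewrite -[X in X + _]mulr_natl -subn1 natrB //; congr (_ + _ * _).
rewrite -natr_sum; congr (_%:R); rewrite /k -sum1dep_card.
rewrite big_mkcond [RHS]big_mkcond.
apply: eq_bigr => y _; case: eqVneq => //= ->; case: Gp => _ -> _.
by rewrite eqxx.
Qed.

(** Subtracting the equations at x and p x gives (a - 1) (f x - f (p x)) = 0, so
    f agrees on the two ends of a blade.  Hence f x is f c / (a - 3) at matched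
    vertices and f c / (a - 1) at the other ones, and the equation at c becomes
    the cubic, since f c = 0 would force f = 0. *)
Lemma windmill_eigenvalueP (a : R) : 3 < a ->
  eigenvalue (signless_laplacian R G) a <-> windmill_poly #|G| k a = 0.
Proof.
move=> a3; have a30 : a - 3 != 0 by rewrite subr_eq0 gt_eqF.
have a10 : a - 1 != 0 by rewrite subr_eq0 gt_eqF //; lra.
pose g y := (a - 3) + 2 * (p y != y)%:R.
have := windmill_rim_total a; rewrite -/g => gE.
have cardE : \sum_(y : G | y != c) 1 = #|G|%:R - 1 :> R.
  have G0 : (0 < #|G|)%N by apply/card_gt0P; exists c.
  by rewrite sumr_const cardC1 -subn1 natrB.
have [pK pc A] := Gp.
rewrite signless_eigenvalueP; split=> [[f fa [z fz]]|Pa0].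
  have rim x : x != c -> (a - 1) * (a - 3) * f x = f c * g x.
    move=> xc; have pxc : p x != c.
      by apply: contraNneq xc => E; rewrite -(pK x) E pc.
    have := fa x; have := fa (p x); rewrite !windmill_sum_rim // pK eq_sym /g.
    case: (p x != x) => /=; last by move=> _ E; rewrite mulr0 addr0 -mulrA; nra.
    move=> E1 E2; suff fE : f (p x) = f x by rewrite fE in E2; nra.
    apply: (mulfI a10); lra.
  have fc : f c != 0.
    apply: contraNneq fz => fc0; have [->|/rim] := eqVneq z c; first exact/eqP.
    by rewrite fc0 mul0r => /eqP; rewrite !mulf_eq0 (negPf a10) (negPf a30).
  have := fa c; rewrite windmill_sum_center big_split /=.
  have -> : \sum_(y | y != c) f c = (#|G|%:R - 1) * f c.
    by rewrite -cardE mulr_suml; apply: eq_bigr => y _; rewrite mul1r.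
  move/(congr1 (fun z => (a - 1) * (a - 3) * z)); rewrite mulrDr mulr_sumr.
  under eq_bigr => y yc do rewrite rim //.
  rewrite -mulr_sumr gE => E; apply: (mulIf fc); rewrite mul0r /windmill_poly.
  by move: E; nra.
exists (fun x => if x == c then (a - 1) * (a - 3) else g x); last first.
  by exists c; rewrite eqxx mulf_neq0.
move=> x; have [->|xc] := eqVneq x c.
  rewrite windmill_sum_center big_split /=.
  have -> : \sum_(y | y != c) (if y == c then (a - 1) * (a - 3) else g y) =
      \sum_(y | y != c) g y by apply: eq_bigr => y /negPf->.
  have -> : \sum_(y | y != c) (a - 1) * (a - 3) =
      (#|G|%:R - 1) * ((a - 1) * (a - 3)).
    by rewrite -cardE mulr_suml; apply: eq_bigr => y _; rewrite mul1r.
  by rewrite gE; move: Pa0; rewrite /windmill_poly => E; nra.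
have pxc : p x != c by apply: contraNneq xc => E; rewrite -(pK x) E pc.
rewrite windmill_sum_rim // eqxx (negPf pxc) /g pK [p x == x]eq_sym.
by case: (x != p x) => /=; ring.
Qed.

End Windmill.

(** The cubic is nonnegative from n + 1 on, so a point where it is negative is
    followed by a root, which is an eigenvalue. *)
Lemma windmill_poly_lt0_Qindex (R : realType) (G : sgraph) (c : G) (p : G -> G)
    (b : R) :
  windmill c p -> (4 <= #|G|)%N -> #|G|%:R <= b ->
  windmill_poly #|G| #|[set x | p x != x]| b < 0 -> b < Qindex R G.
Proof.
move=> Gp n4 nb Pb.
have n4R : (4%:R : R) <= #|G|%:R by rewrite ler_nat.
have kn : (#|[set x | p x != x]|%:R : R) <= #|G|%:R - 1.
  have -> : (#|G|%:R - 1 : R) = (#|G|.-1)%:R by rewrite -subn1 natrB //; lia.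
  rewrite ler_nat -(cardC1 c); apply: subset_leq_card; apply/subsetP => x.
  by rewrite !inE; apply: contraNneq => ->; case: Gp => _ -> _.
move: kn Pb (@windmill_eigenvalueP R _ _ _ Gp); set k := #|[set x | _]|.
set n := #|G| in n4 nb n4R * => kn Pb evP.
pose q : {poly R} := ('X - (n%:R - 1)%:P) * ('X - 3%:P) * ('X - 1%:P)
   - (n%:R - 1)%:P * ('X - 3%:P) - (2 * k%:R)%:P.
have qE z : q.[z] = windmill_poly n k z.
  by rewrite /q /windmill_poly !hornerE; ring.
have top (z : R) : n%:R + 1 <= z -> 0 <= windmill_poly n k z.
  move=> zn; rewrite /windmill_poly.
  have : 0 <= (z - 1) * (2 * (z - 3) - (n%:R - 1)) by apply: mulr_ge0; lra.
  have : 0 <= (z - n%:R - 1) * ((z - 3) * (z - 1)).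
    by apply: mulr_ge0; [lra | apply: mulr_ge0; lra].
  by nra.
have bn : b < n%:R + 1 by rewrite ltNge; apply/negP => /top; rewrite leNgt Pb.
have [||z /andP[bz zn] /rootP] := @poly_ivt _ q b (n%:R + 1).
- exact: ltW.
- by rewrite !qE top // ltW.
rewrite qE => Pz; have bz' : b < z.
  by rewrite lt_neqAle bz andbT; apply: contraTneq Pb => ->; rewrite Pz ltxx.
apply: (lt_le_trans bz').
have [_] := Qindex_max R (leq_trans (isT : (0 < 4)%N) n4); apply.
by apply/evP => //; lra.
Qed.

(** With t = n - 2, e = 1 / t and k = t the value is 1 - t + e^2 + e^3, negative
    because t >= 2. *)
Lemma windmill_poly_lt0 (R : realType) n k : (4 <= n)%N -> (n - 2 <= k)%N ->
  windmill_poly n k (n%:R + (n%:R - 2)^-1 : R) < 0.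
Proof.
move=> n4 nk; set t : R := n%:R - 2.
have n4R : (4%:R : R) <= n%:R by rewrite ler_nat.
have t2 : 2 <= t by rewrite /t; lra.
have kt : t <= k%:R by rewrite /t -natrB ?ler_nat //; lia.
have nE : n%:R = t + 2 by rewrite /t; ring.
set e := t^-1; have te : t * e = 1 by rewrite mulfV // gt_eqF //; lra.
have e0 : 0 < e by rewrite invr_gt0; lra.
have e1 : e <= 1 / 2 by nra.
(* The last summand is zero, as t * e = 1; it makes the identity polynomial. *)
rewrite /windmill_poly nE.
have -> : (t + 2 + e - (t + 2) + 1) * (t + 2 + e - 3) * (t + 2 + e - 1) -
   (t + 2 - 1) * (t + 2 + e - 3) - 2 * k%:R =
   1 + t + e ^+ 2 + e ^+ 3 - 2 * k%:R + (t * e - 1) * (t + 1 + 2 * e).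
  by ring.
rewrite te subrr mul0r addr0.
have : e ^+ 2 <= 1 / 4 by nra.
have : e ^+ 3 <= 1 / 8 by rewrite exprS; nra.
by lra.
Qed.

(** * The friendship graph among windmills *)

(** Numbering the elements of A from 1 so that the orbits of p occupy the pairs
    {1, 2}, {3, 4}, ..., which are the fibres of uphalf.  Induction: an orbit of
    size two is given the labels 1 and 2 and the others are shifted by 2; the
    possible fixed point comes last and takes the largest label. *)
Lemma involution_labelling (T : finType) (p : T -> T) (A : {set T}) :
  involutive p -> (forall x, x \in A -> p x \in A) ->
  (#|[set x in A | p x == x]| <= 1)%N ->
  exists g : T -> nat, (forall x, x \in A -> 0 < g x <= #|A|)%N /\
    {in A &, forall x y,
      (uphalf (g x) == uphalf (g y)) = (x == y) || (p x == y)} /\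
    {in A &, injective g}.
Proof.
move=> pK; have [m] := ubnP #|A|; elim: m A => // m IH A Am pA fix1.
have [fixA|[x xA px]] :
    {in A, forall x, p x = x} \/ exists2 x, x \in A & p x != x.
  have [E|/forall_inPn[x xA px]] := boolP [forall x in A, p x == x];
    [left|right].
    by move=> x xA; apply/eqP; move/forall_inP: E; apply.
  by exists x.
- have A1 : (#|A| <= 1)%N.
    rewrite (leq_trans _ fix1) // subset_leq_card //; apply/subsetP => x xA.
    by rewrite inE xA fixA /=.
  have eqA : {in A &, forall x y, x = y}.
    by move=> x y xA yA; apply: (card_le1_eqP A1).
  exists (fun=> 1%N); split=> [x xA|]; first by apply/card_gt0P; exists x.
  split=> [x y xA yA|x y xA yA _]; last exact: eqA.
  by rewrite (eqA x y xA yA) [y == y]eqxx.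
pose B := A :\ x :\ p x.
have BE y : (y \in B) = [&& y != p x, y != x & y \in A] by rewrite !inE.
have cA : #|A| = #|B|.+2.
  by rewrite (cardsD1 x) xA (cardsD1 (p x)) !inE px pA.
have pB y : y \in B -> p y \in B.
  rewrite !BE => /and3P[yp yx yA]; rewrite pA // andbT.
  rewrite -(inj_eq (can_inj pK)) !pK yx /=.
  by rewrite -(inj_eq (can_inj pK)) pK.
have [||g [gB [gp gI]]] := IH B _ pB.
- by rewrite cA in Am; lia.
- rewrite (leq_trans _ fix1) // subset_leq_card //; apply/subsetP => y.
  by rewrite !inE => /andP[/and3P[_ _ ->] ->].
pose h y := if y == x then 1%N else if y == p x then 2%N else (g y).+2.
have hP y : y \in A -> [\/ y = x /\ h y = 1%N, y = p x /\ h y = 2%N |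
    y \in B /\ h y = (g y).+2].
  rewrite /h BE => ->; case: eqVneq => [->|yx]; first by constructor 1.
  by case: eqVneq => [->|yp]; [constructor 2 | constructor 3].
have gB0 y : y \in B -> (0 < g y)%N by case/gB/andP.
have uh z : (0 < z)%N ->
    (1 == uphalf z.+2) = false /\ (uphalf z.+2 == 1) = false.
  by case: z => // z _; split; apply/eqP => /= -[].
exists h; split; [|split].
- move=> y /hP[[_ ->]|[_ ->]|[yB ->]]; rewrite cA //.
  by have /andP[] := gB y yB; rewrite !ltnS.
- move=> y z /hP[[-> ->]|[-> ->]|[yB ->]] /hP[[-> ->]|[-> ->]|[zB ->]];
    rewrite ?pK ?eqxx ?orbT //.
  + rewrite (uh _ (gB0 _ zB)).1; move: zB; rewrite BE => /and3P[zp zx _].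
    by rewrite ![_ == z]eq_sym (negPf zp) (negPf zx).
  + rewrite (uh _ (gB0 _ zB)).1; move: zB; rewrite BE => /and3P[zp zx _].
    by rewrite ![_ == z]eq_sym (negPf zp) (negPf zx).
  + rewrite (uh _ (gB0 _ yB)).2; have := pB _ yB; move: yB; rewrite !BE.
    by move=> /and3P[_ /negPf-> _] /and3P[_ /negPf-> _].
  + rewrite (uh _ (gB0 _ yB)).2; have := pB _ yB; move: yB; rewrite !BE.
    by move=> /and3P[/negPf-> _ _] /and3P[/negPf-> _ _].
  + by rewrite /= eqSS gp.
- move=> y z /hP[[-> ->]|[-> ->]|[yB ->]] /hP[[-> ->]|[-> ->]|[zB ->]] //.
  + by case=> E; have := gB0 _ zB; rewrite -E.
  + by case=> E; have := gB0 _ yB; rewrite E.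
  by case; apply: gI.
Qed.

(** Vertex c goes to 0 and the others are labelled blade by blade; injectivity
    suffices because the two graphs have the same order. *)
Lemma windmill_isomorphic (G : sgraph) (c : G) (p : G -> G) :
  windmill c p -> (#|[set x | (x != c) && (p x == x)]| <= 1)%N ->
  isomorphic G (friendship #|G|).
Proof.
case=> pK pc A fix1.
have pC x : x != c -> p x != c by apply: contraNneq => E; rewrite -(pK x) E pc.
have [||g [gb [gp gI]]] := @involution_labelling G p [set~ c] pK.
- by move=> x; rewrite !inE; apply: pC.
- rewrite (leq_trans _ fix1) // subset_leq_card //; apply/subsetP => x.
  by rewrite !inE.
have G0 : (0 < #|G|)%N by apply/card_gt0P; exists c.
pose g0 x := if x == c then 0%N else g x.
have g0lt x : (g0 x < #|G|)%N.
  rewrite /g0; case: (eqVneq x c) => // xc.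
  by have := gb x; rewrite in_setC1 xc cardsC1 => /(_ isT); lia.
have g00 x : (g0 x == 0%N) = (x == c).
  rewrite /g0; case: (eqVneq x c) => // xc.
  by have := gb x; rewrite in_setC1 xc => /(_ isT); case: (g x).
have g0I : injective g0.
  move=> x y E; have := g00 x; rewrite E g00 => cE.
  have [yc|yc] := eqVneq y c; first by move: cE; rewrite yc eqxx => /esym/eqP.
  have xc : x != c by rewrite -cE.
  by move: E; rewrite /g0 (negPf xc) (negPf yc); apply: gI; rewrite in_setC1.
exists (fun x => Ordinal (g0lt x) : friendship #|G|).
  apply: inj_card_bij; last by rewrite card_ord.
  by move=> x y [] /g0I.
move=> x y; rewrite A /= /friendship_adj /= !g00 -val_eqE /= (inj_eq g0I).
have [//|xy] := eqVneq x y; rewrite /=.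
have [//|xc] := eqVneq x c; have [//|yc] := eqVneq y c; rewrite /=.
by rewrite /g0 (negPf xc) (negPf yc) gp ?inE // (negPf xy).
Qed.

(** Only the last vertex, n - 1, can be unmatched: an odd x < n - 1 is matched
    with x + 1 and an even x > 0 with x - 1.  So n - 2 is a lower bound for the
    number of matched vertices in both parities. *)
Lemma friendship_windmill n : (4 <= n)%N ->
  exists (c : friendship n) p,
    windmill c p /\ (n - 2 <= #|[set x | p x != x]|)%N.
Proof.
move=> n4; have n0 : (0 < n)%N by lia.
pose c : friendship n := Ordinal n0.
have cE (x : friendship n) : (x == c) = (x == 0 :> nat) by rewrite -val_eqE.
have [||p pP] := @windmill_exists _ c.
- by move=> x xc; rewrite /= /friendship_adj /= eq_sym xc.
- move=> x y z; rewrite !cE => x0 y0 z0.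
  rewrite /= /friendship_adj /= (negPf x0) (negPf y0) (negPf z0) -!val_eqE /=.
  move=> /andP[xy /eqP uxy] /andP[xz /eqP uxz]; apply/val_inj.
  have pair (i j k : nat) : i != j -> i != k ->
      uphalf i = uphalf j -> uphalf i = uphalf k -> j = k.
    by rewrite !uphalfE; lia.
  exact: pair xy xz uxy uxz.
exists c, p; split=> //; have [pK pc A] := pP.
have nl : (n.-1 < n)%N by lia.
pose l : friendship n := Ordinal nl.
suff sub : ~: [set x | p x != x] \subset [set c; l].
  have := subset_leq_card sub; rewrite cards2.
  have := cardsC [set x | p x != x]; rewrite card_ord.
  by case: (c != l) => /=; lia.
apply/subsetP => x; rewrite !inE negbK => /eqP px.
apply/norP => -[xc xl].
have x0 : (0 < x)%N by rewrite lt0n -cE.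
have xn : (x.+1 < n)%N by move: xl (ltn_ord x); rewrite -val_eqE /=; lia.
pose m := if odd x then x.+1 else x.-1.
have mn : (m < n)%N by rewrite /m; case: ifP; lia.
pose y : friendship n := Ordinal mn.
have m0 : (m == 0%N) = false by rewrite /m; case: ifP => ?; lia.
have xm : (x == m :> nat) = false by rewrite /m; case: ifP => ?; lia.
have : adj x y.
  rewrite /= /friendship_adj /= -val_eqE /= xm m0 -cE (negPf xc) /= !uphalfE /m.
  by case: ifP => ?; lia.
by rewrite A px -val_eqE /= xm (negPf xc) cE /= m0.
Qed.

Theorem theorem1 (R : realType) (n : nat) (G : sgraph) :
  (4 <= n)%N -> #|G| = n -> ~ has_subgraph C4 G ->
  ~ isomorphic G (friendship n) ->
  Qindex R G < Qindex R (friendship n).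
Proof.
move=> n4 Gn C4G nisoF.
have [c0 [p0 [F0 k0]]] := friendship_windmill n4.
have cardF : #|friendship n| = n by rewrite card_ord.
have Fgt (b : R) : n%:R <= b ->
    windmill_poly n #|[set x | p0 x != x]| b < 0 -> b < Qindex R (friendship n).
  by move=> nb Pb; apply: (windmill_poly_lt0_Qindex F0); rewrite cardF.
have n4R : (4%:R : R) <= n%:R by rewrite ler_nat.
have e0 : 0 < (n%:R - 2 : R)^-1 by rewrite invr_gt0; lra.
have [] := @Qindex_max R G; first by rewrite Gn; lia.
move: (Qindex R G) => a aG _.
have [ab|ab] := leP a (n%:R + (n%:R - 2)^-1).
  by apply: (le_lt_trans ab); apply: Fgt; [lra | exact: windmill_poly_lt0].
have [c cdeg] : exists c : G, (n - 2 < degree c)%N.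
  have [/existsP[c cP]|] := boolP [exists c : G, (n - 2 < degree c)%N].
    by exists c.
  rewrite negb_exists => /forallP deg; move: ab; rewrite ltNge => /negP[].
  rewrite -Gn; apply: C4_free_eigenvalue_le => //; first by rewrite Gn.
  by move=> x; rewrite leqNgt Gn.
have cadj x : x != c -> adj c x.
  have sub : [set y | adj c y] \subset [set~ c].
    apply/subsetP => y; rewrite !inE.
    by apply: contraTneq => ->; rewrite adj_irr.
  have /eqP : [set y | adj c y] = [set~ c].
    apply/eqP; rewrite eqEcard sub cardsC1 Gn.
    by move: cdeg; rewrite /degree; lia.
  by move=> /eqP/setP/(_ x); rewrite !inE => ->.
have [p Gp] : exists p, windmill c p.
  apply: windmill_exists => // x y z xc yc zc xy xz.
  by apply: (C4_free_common C4G xc xy _ xz); apply: cadj.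
have unmatched : (1 < #|[set x | (x != c) && (p x == x)]|)%N.
  rewrite ltnNge; apply/negP => fix1; apply: nisoF.
  by rewrite -Gn; apply: windmill_isomorphic fix1.
(* The points fixed by p are c and at least two unmatched vertices. *)
have kn : (#|[set x | p x != x]| + 3 <= n)%N.
  rewrite -Gn -(cardsC [set x | p x != x]) leq_add2l.
  rewrite (cardsD1 c) !inE negbK; case: (Gp) => _ -> _; rewrite eqxx ltnS.
  apply: leq_trans unmatched _; apply: subset_leq_card; apply/subsetP => x.
  by rewrite !inE negbK.
apply: Fgt; first by lra.
have Pa : windmill_poly n #|[set x | p x != x]| a = 0.
  by rewrite -Gn; apply/(windmill_eigenvalueP Gp) => //; lra.
have : (#|[set x | p x != x]|%:R : R) < #|[set x | p0 x != x]|%:R.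
  by rewrite ltr_nat; lia.
by move: Pa; rewrite /windmill_poly; lra.
Qed.
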